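(* Let $X$ be a fibrewise space over a topological space $B$, and let $pr_1,pr_2:X\times_B X\to X$ be the projections onto the first and second factors. Then $$\mathrm{TC}_B(X)=D_B(pr_1,pr_2).$$
   Context: Fix a topological space $B$ and let $I=[0,1]$. A fibrewise space over $B$ is a topological space $X$ with a continuous map $p_X:X\to B$; a fibrewise map $f:X\to Y$ is a continuous map with $p_Y\circ f=p_X$. A subspace $U\subset X$ is a fibrewise space via $p_X|_U$. Two fibrewise maps $f,g:X\to Y$ are fibrewise homotopic, $f\simeq_B g$, if there is a continuous $H:X\times I\to Y$ with $H(x,0)=f(x)$, $H(x,1)=g(x)$ and $p_Y(H(x,t))=p_X(x)$ for all $x,t$. The fibrewise product is $X\times_B Y=\{(x,y)\in X\times Y: p_X(x)=p_Y(y)\}$. Parametrized homotopic distance: $D_B(f,g)$ is the smallest integer $n\ge 0$ such that the domain $X$ of the fibrewise maps $f,g:X\to Y$ has an open cover $\{U_0,\dots,U_n\}$ with $f|_{U_i}\simeq_B g|_{U_i}$ for all $i$; it is $\infty$ if no such $n$ exists. Fibrewise sectional category: for a fibrewise map $q:E\to X$, $\mathrm{secat}_B(q)$ is the smallest integer $n\ge 0$ such that $X$ has an open cover $\{U_0,\dots,U_n\}$ together with fibrewise maps $s_i:U_i\to E$ satisfying $q\circ s_i\simeq_B \mathrm{inc}_{U_i}$ for all $i$; it is $\infty$ if no such $n$ exists. Fibrewise (parametrized) topological complexity: $\mathrm{TC}_B(X)=\mathrm{secat}_B(\Pi_X)$, where $P_B(X)=\{(b,\alpha)\in B\times X^I :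 p_X\circ\alpha \text{ is the constant path at } b\}$ (with $X^I$ in the compact-open topology) and $\Pi_X:P_B(X)\to X\times_B X$, $\Pi_X(b,\alpha)=(\alpha(0),\alpha(1))$. *)

(* Defs.v *)
From HB Require Import structures.
From mathcomp Require Import all_boot all_order all_algebra.
From mathcomp Require Import all_classical all_reals topology.

Set Implicit Arguments.
Unset Strict Implicit.
Unset Printing Implicit Defensive.

Import Order.TTheory GRing.Theory Num.Theory numFieldTopology.Exports.

Local Open Scope classical_set_scope.
Local Open Scope ring_scope.

(* A set [A : set T] used as a type is the subtype [set_type A], which the
   library endows with the subspace topology. *)

Lemma val_continuous (T : topologicalType) (A : set T) :
  continuous (\val : set_type A -> T).
Proof. exact: (@initial_continuous (set_type A) T (@set_val T A)). Qed.

Lemma continuous_initial (S : topologicalType) (W : choiceType)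
    (T : topologicalType) (i : W -> T) (f : S -> initial_topology i) :
  continuous (i \o f) -> continuous f.
Proof.
move=> /continuousP cf; apply/continuousP => _ [C oC <-].
exact: (cf C oC).
Qed.

Lemma fst_continuous (T U : topologicalType) : continuous (@fst T U).
Proof. by move=> x; exact: cvg_fst. Qed.

Lemma snd_continuous (T U : topologicalType) : continuous (@snd T U).
Proof. by move=> x; exact: cvg_snd. Qed.

Section UnitInterval.
Variable R : realType.

Definition unit_interval : topologicalType :=
  set_type (`[0, 1]%classic : set R).

Lemma unit_interval0_subproof : (0 : R) \in (`[0, 1]%classic : set R).
Proof. by rewrite inE /= in_itv /= lexx ler01. Qed.

Lemma unit_interval1_subproof : (1 : R) \in (`[0, 1]%classic : set R).
Proof. by rewrite inE /= in_itv /= lexx ler01. Qed.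

Definition I0 : unit_interval := exist _ 0 unit_interval0_subproof.
Definition I1 : unit_interval := exist _ 1 unit_interval1_subproof.

End UnitInterval.

Section Fibrewise.
Variable B : topologicalType.

Record fibSpace := FibSpace {
  fib_total :> topologicalType;
  fib_proj : fib_total -> B;
  fib_proj_continuous : continuous fib_proj }.

Record fibMap (X Y : fibSpace) := FibMap {
  fib_fun :> X -> Y;
  fib_fun_continuous : continuous fib_fun;
  fib_funE : forall x, fib_proj (fib_fun x) = fib_proj x }.

Section Comp.
Variables (X Y Z : fibSpace) (g : fibMap Y Z) (f : fibMap X Y).

Lemma fib_comp_continuous : continuous (g \o f).
Proof. by move=> x; apply: continuous_comp; exact: fib_fun_continuous. Qed.

Lemma fib_compE x : fib_proj ((g \o f) x) = fib_proj x.
Proof. by rewrite /= !fib_funE. Qed.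

Definition fib_comp : fibMap X Z := FibMap fib_comp_continuous fib_compE.

End Comp.

Section Sub.
Variables (X : fibSpace) (U : set X).

Lemma fib_sub_continuous :
  continuous ((@fib_proj X \o \val) : set_type U -> B).
Proof.
move=> x; apply: continuous_comp; first exact: val_continuous.
exact: fib_proj_continuous.
Qed.

Definition fib_sub : fibSpace := FibSpace fib_sub_continuous.

Definition fib_inc : fibMap fib_sub X :=
  @FibMap fib_sub X \val (@val_continuous X U) (fun=> erefl).

End Sub.

Definition fib_restr (X Y : fibSpace) (f : fibMap X Y) (U : set X) :
  fibMap (fib_sub U) Y := fib_comp f (fib_inc U).

Section Prod.
Variables X Y : fibSpace.

Definition fib_prod_set : set (X * Y) :=
  [set z | fib_proj z.1 = fib_proj z.2].

Lemma fib_pr1_continuous : continuous ((fst \o \val) : fib_prod_set -> X).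
Proof.
move=> z; apply: continuous_comp; first exact: val_continuous.
exact: fst_continuous.
Qed.

Lemma fib_pr2_continuous : continuous ((snd \o \val) : fib_prod_set -> Y).
Proof.
move=> z; apply: continuous_comp; first exact: val_continuous.
exact: snd_continuous.
Qed.

Lemma fib_prod_continuous :
  continuous ((@fib_proj X \o (fst \o \val)) : fib_prod_set -> B).
Proof.
move=> z; apply: continuous_comp; first exact: fib_pr1_continuous.
exact: fib_proj_continuous.
Qed.

Definition fib_prod : fibSpace := FibSpace fib_prod_continuous.

Definition pr1 : fibMap fib_prod X :=
  @FibMap fib_prod X (fst \o \val) fib_pr1_continuous (fun=> erefl).

Lemma fib_pr2E (z : fib_prod) : fib_proj (val z).2 = fib_proj z.
Proof. by rewrite /= -(set_valP z). Qed.

Definition pr2 : fibMap fib_prod Y :=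
  @FibMap fib_prod Y (snd \o \val) fib_pr2_continuous fib_pr2E.

End Prod.

Section Invariants.
Variable R : realType.
Local Notation I := (unit_interval R).

Definition fib_homotopic (X Y : fibSpace) (f g : fibMap X Y) : Prop :=
  exists H : X * I -> Y,
    [/\ continuous H,
        forall x, H (x, I0 R) = f x,
        forall x, H (x, I1 R) = g x &
        forall x t, fib_proj (H (x, t)) = fib_proj x].

Definition least_or_infty (P : set nat) : \bar nat :=
  match pselect (exists n, `[< P n >]) with
  | left exP => (ex_minn exP)%:E
  | right _ => +oo%E
  end.

Definition fib_distance_le (X Y : fibSpace) (f g : fibMap X Y) (n : nat) :
    Prop :=
  exists U : 'I_n.+1 -> set X,
    [/\ forall i, open (U i),
        \bigcup_i U i = setT &
        forall i, fib_homotopic (fib_restr f (U i)) (fib_restr g (U i))].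

Definition fib_distance (X Y : fibSpace) (f g : fibMap X Y) : \bar nat :=
  least_or_infty (fib_distance_le f g).

Definition fib_secat_le (E X : fibSpace) (q : fibMap E X) (n : nat) : Prop :=
  exists U : 'I_n.+1 -> set X,
    [/\ forall i, open (U i),
        \bigcup_i U i = setT &
        forall i, exists s : fibMap (fib_sub (U i)) E,
          fib_homotopic (fib_comp q s) (fib_inc (U i))].

Definition fib_secat (E X : fibSpace) (q : fibMap E X) : \bar nat :=
  least_or_infty (fib_secat_le q).

(* [X^I]: the library puts no default topology on [continuousType]; this alias
   carries the compact-open one. *)
Definition path_space (X : topologicalType) : Type := continuousType I X.

HB.instance Definition _ (X : topologicalType) := Choice.on (path_space X).
HB.instance Definition _ (X : topologicalType) :=
  Topological.copy (path_space X)
    (@initial_topology (path_space X) {compact-open, I -> X}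
       (fun a : continuousType I X => a : I -> X)).

Definition path_eval (X : topologicalType) (t : I) (a : path_space X) : X :=
  (a : continuousType I X) t.

Lemma path_eval_continuous (X : topologicalType) (t : I) :
  continuous (@path_eval X t).
Proof.
apply/continuousP => O oO.
have := @compact_open_open I X [set t] O (@compact_set1 I t) oO.
move=> oS; exists [set g | g @` [set t] `<=` O] => //.
apply/seteqP; split => a /= Oa; first by apply: Oa; exists t.
by move=> _ [_ -> <-].
Qed.

Section PathFib.
Variable X : fibSpace.

Definition fib_path_set : set (B * path_space X) :=
  [set z | forall t, fib_proj (path_eval t z.2) = z.1].

Lemma fib_path_continuous :
  continuous ((fst \o \val) : fib_path_set -> B).
Proof.
move=> z; apply: continuous_comp; first exact: val_continuous.
exact: fst_continuous.
Qed.

Definition fib_path : fibSpace := FibSpace fib_path_continuous.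

Definition path_ends (z : fib_path) : X * X :=
  (path_eval (I0 R) (val z).2, path_eval (I1 R) (val z).2).

Lemma path_ends_subproof z : path_ends z \in @fib_prod_set X X.
Proof. by rewrite inE /fib_prod_set /= !(set_valP z). Qed.

Definition path_fibration_fun (z : fib_path) : fib_prod X X :=
  exist _ (path_ends z) (path_ends_subproof z).

Lemma path_fibration_continuous : continuous path_fibration_fun.
Proof.
have ev t : continuous ((@path_eval X t \o (snd \o \val)) : fib_path_set -> X).
  move=> z; apply: continuous_comp; last exact: path_eval_continuous.
  apply: continuous_comp; first exact: val_continuous.
  exact: snd_continuous.
apply: (@continuous_initial fib_path (set_type (@fib_prod_set X X)) (X * X)%type
  (@set_val _ (@fib_prod_set X X)) path_fibration_fun) => z.
exact: (cvg_pair (ev (I0 R) z) (ev (I1 R) z)).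
Qed.

Lemma path_fibrationE z : fib_proj (path_fibration_fun z) = fib_proj z.
Proof. exact: (set_valP z). Qed.

Definition path_fibration : fibMap fib_path (fib_prod X X) :=
  FibMap path_fibration_continuous path_fibrationE.

End PathFib.

Definition fib_TC (X : fibSpace) : \bar nat := fib_secat (path_fibration X).

End Invariants.
End Fibrewise.

Arguments pr1 {B} X Y.
Arguments pr2 {B} X Y.

(* Main.v *)
Require Import Defs.
From mathcomp Require Import all_boot all_order all_algebra.
From mathcomp Require Import all_classical all_reals topology normedtype.
From mathcomp Require Import lra.

(** Both invariants are the least [n] for which the fibrewise square of [X] has
    a cover by [n+1] open sets of a certain kind, so it is enough that the two
    kinds of open sets agree: [pr1] and [pr2] are fibrewise homotopic on [U] if
    and only if the inclusion of [U] lifts, up to fibrewise homotopy, through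
    the path fibration. This holds for every fibrewise map [h] into the
    fibrewise square in place of an inclusion ([fib_homotopic_iff_lift]).

    A fibrewise homotopy from [pr1 h] to [pr2 h] is, by currying, a fibrewise
    map [s] to the path space; the end points of its paths are the coordinates
    of [h], so it lifts [h] strictly. Currying preserves continuity for the
    compact-open topology without any condition on the spaces.

    Conversely, evaluation of paths is a universal fibrewise homotopy between
    the two end-point maps ([path_fibration_homotopic]); it is continuous
    because the unit interval is compact and regular. For a homotopy lift [s]
    of [h], with path fibration [q], this gives the chain
    pr1 h ~= pr1 q s ~= pr2 q s ~= pr2 h,
    and it remains that fibrewise homotopy is a symmetric and transitive
    relation compatible with composition. *)

Set Implicit Arguments.
Unset Strict Implicit.
Unset Printing Implicit Defensive.

Import Order.TTheory GRing.Theory Num.Theory.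
Import numFieldNormedType.Exports.

Local Open Scope classical_set_scope.
Local Open Scope ring_scope.

Lemma pair_continuous (S T U : topologicalType) (f : S -> T) (g : S -> U) :
  continuous f -> continuous g -> continuous (fun z => (f z, g z)).
Proof. by move=> cf cg z; exact: (cvg_pair (cf z) (cg z)). Qed.

Lemma comp_continuous (S T U : topologicalType) (f : S -> T) (g : T -> U) :
  continuous f -> continuous g -> continuous (fun z => g (f z)).
Proof. by move=> cf cg z; apply: continuous_comp; [exact: cf|exact: cg]. Qed.

Section Clamp.
Variable R : realType.
Local Notation I := (unit_interval R).

Lemma clamp_subproof (r : R) :
  Num.max 0 (Num.min 1 r) \in (`[0, 1]%classic : set R).
Proof.
by rewrite inE /= in_itv /= le_max lexx /= ge_max ler01 ge_min lexx.
Qed.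

(** The retraction of the real line onto the unit interval. It lets a homotopy
    be reparametrized by any continuous real function of time, without a proof
    that the values stay in the interval; it also shows the interval compact,
    as the image of a segment. *)
Definition clamp (r : R) : I :=
  exist (fun x : R => x \in (`[0, 1]%classic : set R)) _ (clamp_subproof r).

Lemma clamp_continuous : continuous clamp.
Proof.
apply: (@continuous_initial R (set_type (`[0, 1]%classic : set R)) R
  (@set_val _ (`[0, 1]%classic : set R)) clamp) => r.
apply: (@continuous_max R R (fun=> 0) (fun r => Num.min 1 r)).
  exact: cvg_cst.
apply: (@continuous_min R R (fun=> 1) id); first exact: cvg_cst.
exact: cvg_id.
Qed.

Lemma unit_intervalP (t : I) : 0 <= val t <= 1.
Proof. by have := set_valP t; rewrite /= in_itv. Qed.

Lemma clampK (t : I) : clamp (val t) = t.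
Proof.
have /andP[t0 t1] := unit_intervalP t.
by apply: val_inj => /=; rewrite (min_r t1) (max_r t0).
Qed.

Lemma clamp_le0 (r : R) : r <= 0 -> clamp r = I0 R.
Proof.
move=> r0; apply: val_inj => /=.
by rewrite (min_r (le_trans r0 ler01)) (max_l r0).
Qed.

Lemma clamp_ge1 (r : R) : 1 <= r -> clamp r = I1 R.
Proof.
by move=> r1; apply: val_inj => /=; rewrite (min_l r1) (max_r ler01).
Qed.

Lemma unit_interval_compact : compact [set: I].
Proof.
have -> : [set: I] = clamp @` `[0, 1].
  apply/seteqP; split => // t _; exists (val t); last exact: clampK.
  by rewrite /= in_itv /= unit_intervalP.
apply: continuous_compact; last exact: segment_compact.
exact/continuous_subspaceT/clamp_continuous.
Qed.

Lemma unit_interval_locally_compact : locally_compact [set: I].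
Proof.
move=> t _; rewrite withinET; exists setT; first exact: filterT.
by split; [exact: unit_interval_compact|exact: closedT].
Qed.

Lemma unit_interval_regular : regular_space I.
Proof. exact: (@uniform_regular (set_type (`[0, 1]%classic : set R))). Qed.

End Clamp.

Section Homotopy.
Variables (R : realType) (B : topologicalType).
Local Notation I := (unit_interval R).
Local Notation "f ~= g" := (fib_homotopic R f g) (at level 70).
Implicit Types X Y Z : fibSpace B.

Lemma time_continuous (X : topologicalType) :
  continuous (fun z : X * I => val z.2 : R).
Proof.
exact: (comp_continuous (@snd_continuous X I) (@val_continuous R `[0, 1])).
Qed.

Lemma reparam_continuous (X : topologicalType) (phi : R -> R) :
  continuous phi ->
  continuous (fun z : X * I => (z.1, clamp (phi (val z.2)))).
Proof.
move=> cphi; apply: pair_continuous; first exact: fst_continuous.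
apply: (comp_continuous (g := @clamp R)); last exact: clamp_continuous.
exact: (comp_continuous (@time_continuous X) cphi).
Qed.

Lemma fib_homotopic_eq X Y (f g : fibMap X Y) : f =1 g -> f ~= g.
Proof.
move=> fg; exists (fun z => f z.1); split => //=; last first.
  by move=> x t; rewrite fib_funE.
exact: (comp_continuous (@fst_continuous X I) (@fib_fun_continuous B X Y f)).
Qed.

Lemma fib_homotopic_sym X Y (f g : fibMap X Y) : f ~= g -> g ~= f.
Proof.
move=> [H [cH H0 H1 pH]].
exists (fun z => H (z.1, clamp (1 - val z.2))); split => //=.
- have crev : continuous (fun r : R => 1 - r).
    by move=> r; apply: cvgB; [exact: cvg_cst|exact: cvg_id].
  exact: (comp_continuous (@reparam_continuous X _ crev) cH).
- by move=> x; rewrite clamp_ge1 ?subr0.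
- by move=> x; rewrite clamp_le0 ?subrr.
Qed.

(** The first homotopy runs at double speed on the first half of the interval
    and the second one on the second half; the pasting lemma for two closed
    sets gives continuity. *)
Lemma fib_homotopic_trans X Y (f g h : fibMap X Y) :
  f ~= g -> g ~= h -> f ~= h.
Proof.
move=> [H [cH H0 H1 pH]] [K [cK K0 K1 pK]].
pose HL (z : X * I) : Y := H (z.1, clamp (2 * val z.2)).
pose KL (z : X * I) : Y := K (z.1, clamp (2 * val z.2 - 1)).
have c2 : continuous (fun r : R => 2 * r) by exact: mulrl_continuous.
have c21 : continuous (fun r : R => 2 * r - 1).
  by move=> r; apply: cvgB; [exact: c2|exact: cvg_cst].
have cHL : continuous HL := comp_continuous (@reparam_continuous X _ c2) cH.
have cKL : continuous KL := comp_continuous (@reparam_continuous X _ c21) cK.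
pose G (z : X * I) : Y := if val z.2 <= 2^-1 then HL z else KL z.
pose L := [set z : X * I | val z.2 <= 2^-1].
pose M := [set z : X * I | 2^-1 <= val z.2].
have clL : closed L.
  by apply: (closed_comp _ (@closed_le R 2^-1)) => z _; exact: time_continuous.
have clM : closed M.
  by apply: (closed_comp _ (@closed_ge R 2^-1)) => z _; exact: time_continuous.
have GL : {in L, HL =1 G} by move=> z; rewrite inE /G /L /= => ->.
(* At time 1/2 the first homotopy has ended and the second one starts: both
   are [g]. *)
have GM : {in M, KL =1 G}.
  move=> z; rewrite inE /G /M /= => Mz; case: ifPn => // Lz.
  have zE : val z.2 = 2^-1 :> R by apply/eqP; rewrite eq_le Lz Mz.
  by rewrite /HL /KL zE mulfV ?pnatr_eq0 // subrr clamp_le0 // clamp_ge1 // H1 K0.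
have cG : continuous G.
  apply/continuous_subspace_setT.
  have -> : [set: X * I] = L `|` M.
    apply/seteqP; split => // z _.
    by case/orP: (le_total (val z.2) 2^-1); [left|right].
  apply: withinU_continuous => //.
  - by apply: (subspace_eq_continuous GL); exact: continuous_subspaceT.
  - by apply: (subspace_eq_continuous GM); exact: continuous_subspaceT.
exists G; split => //.
- by move=> x; rewrite /G /HL /= invr_ge0 ler0n mulr0 clamp_le0.
- move=> x; rewrite /G /KL /= ifF; last by apply/negbTE; rewrite -ltNge; lra.
  by rewrite clamp_ge1 //; lra.
- by move=> x t; rewrite /G /HL /KL; case: ifP => _; rewrite ?pH ?pK.
Qed.

Lemma fib_homotopic_postcomp X Y Z (k : fibMap Y Z) (f g : fibMap X Y) :
  f ~= g -> fib_comp k f ~= fib_comp k g.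
Proof.
move=> [H [cH H0 H1 pH]]; exists (fun z => k (H z)); split => /=.
- exact: (comp_continuous cH (@fib_fun_continuous B Y Z k)).
- by move=> x; rewrite H0.
- by move=> x; rewrite H1.
- by move=> x t; rewrite fib_funE pH.
Qed.

Lemma fib_homotopic_precomp X Y Z (k : fibMap X Y) (f g : fibMap Y Z) :
  f ~= g -> fib_comp f k ~= fib_comp g k.
Proof.
move=> [H [cH H0 H1 pH]]; exists (fun z => H (k z.1, z.2)); split => //=.
- apply: (comp_continuous (f := fun z : X * I => (k z.1, z.2))) cH.
  apply: pair_continuous; last exact: snd_continuous.
  exact: (comp_continuous (@fst_continuous X I) (@fib_fun_continuous B X Y k)).
- by move=> x t; rewrite pH fib_funE.
Qed.

(** Continuity in the path and the time together, which for the compact-open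
    topology rests on the interval being locally compact and regular. *)
Lemma path_eval_jointly_continuous (X : topologicalType) :
  continuous (fun z : path_space R X * I => path_eval z.2 z.1).
Proof.
have cid : continuous
    ((fun a t => path_eval t a) : path_space R X -> {compact-open, I -> X}).
  exact: initial_continuous.
have -> : (fun z : path_space R X * I => path_eval z.2 z.1) =
    uncurry (fun a t => path_eval t a) by apply/funext => -[].
apply: (continuous_uncurry_regular (@unit_interval_locally_compact R)
  (@unit_interval_regular R) cid) => a.
exact: (@cts_fun _ _ (a : continuousType I X)).
Qed.

(** A path in the fibrewise path space moves its start to its end inside one
    fibre, so evaluation at time [t] is a fibrewise homotopy. *)
Lemma path_fibration_homotopic X :
  fib_comp (pr1 X X) (path_fibration R X) ~=
  fib_comp (pr2 X X) (path_fibration R X).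
Proof.
exists (fun z : fib_path R X * I => path_eval z.2 (val z.1).2); split => //=.
- apply: (comp_continuous (f := fun z : fib_path R X * I => ((val z.1).2, z.2)))
    (@path_eval_jointly_continuous X).
  apply: pair_continuous; last exact: snd_continuous.
  apply: (comp_continuous (f := fun z : fib_path R X * I => val z.1))
    (@snd_continuous B (path_space R X)).
  exact: (comp_continuous (@fst_continuous (fib_path R X) I)
    (@val_continuous (B * path_space R X)%type (@fib_path_set B R X))).
- by move=> z t; exact: (set_valP z).
Qed.

Definition adjoint_path Z X (H : Z * I -> X) (cH : continuous H) (z : Z) :
    path_space R X :=
  mkcts ((continuous_curry cH).2 z).

Lemma adjoint_path_continuous Z X (H : Z * I -> X) (cH : continuous H) :
  continuous (adjoint_path cH).
Proof.
apply: (@continuous_initial Z (path_space R X) {compact-open, I -> X}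
  (fun a : continuousType I X => a : I -> X)).
exact: (continuous_curry_fun cH).
Qed.

(** The key equivalence: fibrewise homotopies between the two coordinates of
    [h] correspond to families of paths in fibres, and a family of paths whose
    end points agree with [h] only up to homotopy can be corrected by moving
    along the two coordinates of that homotopy. *)
Lemma fib_homotopic_iff_lift Z X (h : fibMap Z (fib_prod X X)) :
  fib_comp (pr1 X X) h ~= fib_comp (pr2 X X) h <->
  exists s : fibMap Z (fib_path R X), fib_comp (path_fibration R X) s ~= h.
Proof.
split; last first.
  move=> [s sh].
  apply: (fib_homotopic_trans
    (fib_homotopic_sym (fib_homotopic_postcomp (pr1 X X) sh))).
  apply: fib_homotopic_trans (fib_homotopic_postcomp (pr2 X X) sh).
  exact: (fib_homotopic_precomp s (path_fibration_homotopic X)).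
move=> [H [cH H0 H1 pH]].
have s_subproof z : (fib_proj z, adjoint_path cH z) \in @fib_path_set B R X.
  by rewrite inE => t; exact: pH.
pose s z : fib_path R X := exist (fun p => p \in @fib_path_set B R X) _ (s_subproof z).
have cs : continuous s.
  apply: (@continuous_initial Z (set_type (@fib_path_set B R X))
    (B * path_space R X)%type
    (@set_val _ (@fib_path_set B R X)) s).
  exact: (pair_continuous (@fib_proj_continuous B Z)
    (@adjoint_path_continuous Z X H cH)).
exists (@FibMap B Z (fib_path R X) s cs (fun=> erefl)).
apply: fib_homotopic_eq => z; apply: val_inj.
rewrite [RHS]surjective_pairing.
exact: (congr2 pair (H0 z) (H1 z)).
Qed.

End Homotopy.

Theorem corollary3p5 (R : realType) (B : topologicalType) (X : fibSpace B) :
  fib_TC R X = fib_distance R (pr1 X X) (pr2 X X).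
Proof.
congr least_or_infty; apply/funext => n; apply/propext.
split=> -[U [oU cU hU]]; exists U; split => // i.
  exact: (fib_homotopic_iff_lift R (fib_inc (U i))).2 (hU i).
exact: (fib_homotopic_iff_lift R (fib_inc (U i))).1 (hU i).
Qed.
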